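(* Let $V$ be a 3-dimensional complex vector space with a Hermitian form $h$ of signature $(2,1)$. Let $z_1,z_2,z_3\in V$ be linearly independent non-null vectors such that the restrictions of $h$ to $\langle z_1,z_2\rangle$ and $\langle z_2,z_3\rangle$ are nondegenerate. Put $a_i=h(z_i,z_i)$, $h_{ij}=h(z_i,z_j)$, $\Delta_{ij}=a_ia_j-|h_{ij}|^2$. Let $p_3$ be a nonzero vector with $h(p_3,z_1)=h(p_3,z_2)=0$ and $p_1$ a nonzero vector with $h(p_1,z_2)=h(p_1,z_3)=0$, and suppose $p_3,p_1$ are non-null. Let $$s_2=1-\frac{|h(p_3,p_1)|^2}{h(p_3,p_3)h(p_1,p_1)}$$ be the vertex spread at $z_2$. Then $$1-s_2=\frac{|h_{12}h_{23}-a_2h_{13}|^2}{\Delta_{12}\Delta_{23}}.$$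
   Context: $h$ is linear in the first argument and conjugate-linear in the second; a vector $z$ is non-null if $h(z,z)\neq0$. *)

(* Defs.v *)
From HB Require Import structures.
From mathcomp Require Import all_boot all_order all_algebra.
From mathcomp Require Import sesquilinear complex reals.

Set Implicit Arguments.
Unset Strict Implicit.
Unset Printing Implicit Defensive.

Import Order.TTheory GRing.Theory Num.Theory.
Local Open Scope ring_scope.

(* Hermitian forms, linear in the first argument and conjugate-linear in the
   second. *)
Notation hermitian_form V := {hermitian_sym V for Num.conj}.

Section HermitianForms.
Variables (C : numClosedFieldType) (V : vectType C) (h : hermitian_form V).

(* In a [numClosedFieldType], [0 < x] and [x < 0] entail that [x] is real.
   Since [s ++ t] is a basis, such a form is nondegenerate and
   [p + q = \dim V]. *)
Definition has_signature (p q : nat) : Prop :=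
  exists (s : p.-tuple V) (t : q.-tuple V),
    [/\ basis_of {:V} (s ++ t),
        pairwise_orthogonal h (s ++ t),
        {in s, forall u, 0 < h u u} &
        {in t, forall u, h u u < 0}].

Definition non_null (z : V) : Prop := h z z != 0.

Definition nondegenerate_on (W : {vspace V}) : Prop :=
  (W :&: orthov h W == 0)%VS.

Definition gram_det (x y : V) : C := h x x * h y y - `|h x y| ^+ 2.

Definition spread (p q : V) : C := 1 - `|h p q| ^+ 2 / (h p p * h q q).

End HermitianForms.

(* Main.v *)
(* Let w1 and w3 be the components of z1 and z3 orthogonal to z2, scaled by a2.
   In the plane orthogonal to z2, p3 is orthogonal to w1 and p1 to w3, and
   turning both vectors of a pair into their orthogonal complements in a
   Hermitian plane preserves the spread.  So s2 is the spread of w1 and w3,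
   whose Gram matrix is explicit in the h_ij. *)
Require Import Defs.
From HB Require Import structures.
From mathcomp Require Import all_boot all_order all_algebra.
From mathcomp Require Import sesquilinear complex reals ring.

Set Implicit Arguments.
Unset Strict Implicit.
Unset Printing Implicit Defensive.

Import Order.TTheory GRing.Theory Num.Theory.
Local Open Scope ring_scope.


Section OrthogonalVectors.
Variables (C : numClosedFieldType) (V : vectType C) (h : hermitian_form V).

Lemma form_conj u v : h u v = (h v u)^*.
Proof. by rewrite hermC expr0 mul1r. Qed.

Lemma form_orthoC u v : h u v = 0 -> h v u = 0.
Proof. by rewrite form_conj => /eqP; rewrite conjC_eq0 => /eqP. Qed.

(** Trades squared moduli for products of values of [h], which [ring] and [field] can handle. *)
Lemma formN_mulC u v : `|h u v| ^+ 2 = h u v * h v u.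
Proof. by rewrite normCK [h v u]form_conj. Qed.

Section OrthogonalBasis.
Variables (n : nat) (e : n.-tuple V).
Hypothesis e_ortho : forall i j : 'I_n, i != j -> h e`_i e`_j = 0.
Hypothesis e_nn : forall i : 'I_n, non_null h e`_i.

Lemma form_sum_ortho (k : 'I_n -> C) (j : 'I_n) :
  h (\sum_i k i *: e`_i) e`_j = k j * h e`_j e`_j.
Proof.
rewrite linear_sumlz (bigD1 j) //= big1 ?addr0 ?linearZl_LR // => i ij.
by rewrite linearZl_LR /= e_ortho // mulr0.
Qed.

Lemma ortho_free : free e.
Proof.
apply/freeP => k sum0 j; apply/eqP.
have := form_sum_ortho k j; rewrite sum0 linear0l => /esym/eqP.
by rewrite mulf_eq0 (negPf (e_nn j)) orbF.
Qed.

(** By [ortho_free] the [e_i] form a basis, and pairing [u] with [e_i] gives its coordinate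
    [h u e_i / h e_i e_i]. The values [h e_i e_i] may have either sign. *)
Lemma form_ortho_expansion u v : \dim {:V} = n ->
  h u v = \sum_(i < n) h u e`_i * h e`_i v / h e`_i e`_i.
Proof.
move=> dimV.
have e_basis : basis_of fullv e.
  by rewrite basisEfree ortho_free subvf dimV size_tuple leqnn.
have uE := coord_basis e_basis (memvf u).
rewrite {1}uE linear_sumlz; apply: eq_bigr => i _.
rewrite linearZl_LR {2}uE form_sum_ortho /=.
by have := e_nn i; rewrite /non_null => nz; field.
Qed.

End OrthogonalBasis.

(** Since [z], [w], [p] form an orthogonal basis, the form on the plane orthogonal to [z] splits
    along [w] and [p]. Expanding [p'] and [w'] this way leaves an identity between fractions. *)
Lemma spread_orthocomplement z w w' p p' : \dim {:V} = 3%N ->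
  h w z = 0 -> h w' z = 0 -> h p z = 0 -> h p' z = 0 ->
  h p w = 0 -> h p' w' = 0 ->
  non_null h z -> non_null h w -> non_null h w' ->
  non_null h p -> non_null h p' ->
  spread h p p' = spread h w w'.
Proof.
move=> dimV wz w'z pz p'z pw p'w' nz nw nw' np np'.
have zw := form_orthoC wz; have zp := form_orthoC pz.
have wp := form_orthoC pw; have w'p' := form_orthoC p'w'.
have expand u v : h u z = 0 ->
    h u v = h u w * h w v / h w w + h u p * h p v / h p p.
  move=> uz; rewrite (@form_ortho_expansion 3 [tuple z; w; p]) //.
  - by rewrite !big_ord_recl big_ord0 /= uz !mul0r add0r addr0.
  - by case=> [[|[|[]]] //= ?] [[|[|[]]] //= ?].
  - by case=> [[|[|[]]] //=].
congr (1 - _); rewrite !formN_mulC; rewrite /non_null in nw nw' np np'.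
have Ep' := expand p' p' p'z; have Ew' := expand w' w' w'z.
(* The expansions of [h p' w' = 0] and of its conjugate make the [w]-term the opposite of the
   [p]-term. *)
have /eqP := expand p' w' p'z; rewrite p'w' eq_sym addr_eq0 => /eqP E1.
have /eqP := expand w' p' w'z; rewrite w'p' eq_sym addr_eq0 => /eqP E2.
(* After clearing denominators the two sides differ by a product of two cross
   terms, which E1 and E2 exchange. *)
apply/eqP; rewrite eqr_div ?mulf_neq0 // Ep' Ew'; apply/eqP.
transitivity (h p p' * h p' p * (h w' w * h w w') +
    h w w * h p p * ((h p' p * h p w' / h p p) * (h w' p * h p p' / h p p))).
  by field; rewrite nw np.
transitivity (h p p' * h p' p * (h w' w * h w w') +
    h w w * h p p * ((h p' w * h w w' / h w w) * (h w' w * h w p' / h w w))).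
  by rewrite E1 E2 mulrNN.
by field; rewrite nw np.
Qed.

(** The projection of [x] off [z], multiplied by [h z z] to avoid a division. *)
Definition ortho_part z x := h z z *: x - h x z *: z.

Lemma form_ortho_partl z x : h (ortho_part z x) z = 0.
Proof. by rewrite linearBl !linearZl_LR /= mulrC subrr. Qed.

(** The first argument is orthogonal to [z], so only the [y] term of the second contributes; its
    conjugated coefficient [h z z] is real. *)
Lemma form_ortho_part z x y :
  h (ortho_part z x) (ortho_part z y) =
  h z z * (h z z * h x y - h x z * h z y).
Proof.
rewrite {2}/ortho_part linearBr !linearZr_LR /= form_ortho_partl mulr0 subr0.
by rewrite -form_conj /ortho_part linearBl !linearZl_LR.
Qed.

Lemma form_ortho_part_diag z x :
  h (ortho_part z x) (ortho_part z x) = h z z * gram_det h x z.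
Proof. by rewrite form_ortho_part /gram_det formN_mulC; ring. Qed.

Lemma gram_detC x y : gram_det h x y = gram_det h y x.
Proof. by rewrite /gram_det !formN_mulC; ring. Qed.

(** The pairing of [ortho_part y x] with [x] is the Gram determinant. If that vanished,
    [ortho_part y x] would lie in the radical of the span, hence be zero, and [x] would be a
    multiple of [y]. *)
Lemma gram_det_neq0 x y :
  free [:: x; y] -> non_null h y -> nondegenerate_on h <<[:: x; y]>>%VS ->
  gram_det h x y != 0.
Proof.
move=> free_xy ny /eqP ndeg; apply/eqP => det0.
have xW : x \in <<[:: x; y]>>%VS by rewrite memv_span ?mem_head.
have yW : y \in <<[:: x; y]>>%VS by rewrite memv_span // !inE eqxx orbT.
have wW : ortho_part y x \in <<[:: x; y]>>%VS by rewrite rpredB ?rpredZ.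
have wx : h (ortho_part y x) x = 0.
  rewrite linearBl !linearZl_LR /= -[RHS]det0 /gram_det formN_mulC.
  by rewrite [h x x * _]mulrC.
have : ortho_part y x \in (<<[:: x; y]>> :&: orthov h <<[:: x; y]>>)%VS.
  by rewrite memv_cap wW memvE span_cons span_seq1 orthovD !orthov11 wx
             form_ortho_partl eqxx.
rewrite ndeg memv0 subr_eq0 => /eqP xyE.
move: free_xy; rewrite free_cons span_seq1 => /andP[/negP[]].
have : h y y *: x \in <[y]>%VS by rewrite xyE memvZ ?memv_line.
by rewrite rpredZeq (negPf ny).
Qed.

End OrthogonalVectors.

Theorem proposition10p4 (R : realType) (V : vectType R[i])
    (h : hermitian_form V) (z1 z2 z3 p1 p3 : V)
    (dimV : \dim {:V} = 3%N)
    (sig_h : has_signature h 2 1)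
    (free_z : free [:: z1; z2; z3])
    (nn_z1 : non_null h z1) (nn_z2 : non_null h z2) (nn_z3 : non_null h z3)
    (ndeg12 : nondegenerate_on h <<[:: z1; z2]>>%VS)
    (ndeg23 : nondegenerate_on h <<[:: z2; z3]>>%VS)
    (p3_neq0 : p3 != 0) (p3_z1 : h p3 z1 = 0) (p3_z2 : h p3 z2 = 0)
    (p1_neq0 : p1 != 0) (p1_z2 : h p1 z2 = 0) (p1_z3 : h p1 z3 = 0)
    (nn_p3 : non_null h p3) (nn_p1 : non_null h p1) :
  let a2 := h z2 z2 in
  let h12 := h z1 z2 in
  let h23 := h z2 z3 in
  let h13 := h z1 z3 in
  let Delta12 := gram_det h z1 z2 in
  let Delta23 := gram_det h z2 z3 in
  let s2 := spread h p3 p1 in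
  1 - s2 = `|h12 * h23 - a2 * h13| ^+ 2 / (Delta12 * Delta23).
Proof.
move=> a2 h12 h23 h13 Delta12 Delta23 s2.
have [free12 free23] : free [:: z1; z2] /\ free [:: z2; z3].
  split; last by move: free_z; rewrite free_cons => /andP[].
  by apply: (catl_free (Y := [:: z3])).
have D12_neq0 : Delta12 != 0 by apply: gram_det_neq0.
(* The vector projected along, here [z2], comes second both in [gram_det_neq0] and in
   [form_ortho_part_diag]. *)
have D32_neq0 : gram_det h z3 z2 != 0.
  have perm32 : perm_eq [:: z3; z2] [:: z2; z3] by apply/permPl/(perm_catC [:: z3]).
  apply: gram_det_neq0 => //; first by rewrite (perm_free perm32).
  by rewrite (eq_span (perm_mem perm32)).
have s2E : s2 = spread h (ortho_part h z2 z1) (ortho_part h z2 z3).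
  apply: (spread_orthocomplement (z := z2)) => //; rewrite ?form_ortho_partl //.
  - by rewrite linearBr !linearZr_LR /= p3_z1 p3_z2 !mulr0 subrr.
  - by rewrite linearBr !linearZr_LR /= p1_z3 p1_z2 !mulr0 subrr.
  - by rewrite /non_null form_ortho_part_diag mulf_neq0.
  - by rewrite /non_null form_ortho_part_diag mulf_neq0.
rewrite s2E /spread subKr !form_ortho_part_diag form_ortho_part.
rewrite -/a2 -/h12 -/h23 -/h13 -/Delta12 [gram_det h z3 z2]gram_detC -/Delta23.
have a2_neq0 : a2 != 0 by [].
have D23_neq0 : Delta23 != 0 by rewrite /Delta23 gram_detC.
(* As [a2] is real, the factor [|a2|^2] of the numerator cancels the two factors [a2] in the
   denominator. *)
have a2_real : `|a2| ^+ 2 = a2 ^+ 2 by rewrite formN_mulC expr2.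
rewrite normrM exprMn a2_real distrC.
by field; rewrite a2_neq0 D12_neq0 D23_neq0.
Qed.
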